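(* Let $n\ge 3$, $K=\mathbb R^n_+$, $d\in\mathbb R^n$, let $\tau$ be a permutation of $[n]$ such that $$d_{\tau(1)}<d_{\tau(2)}=\dots=d_{\tau(n)},$$ and let $A=\operatorname{diag}(d)$. Let $b=(b_1,\dots,b_n)^\top\in\mathbb R^n$, $c\in\mathbb R$, and let $f:\mathbb S^n\cap\operatorname{int}(K)\to\mathbb R$ be defined by $f(x)=\langle Ax,x\rangle+\langle b,x\rangle+c$. If $b_{\tau(1)}\le 2\left(d_{\tau(2)}-d_{\tau(1)}\right)$ and $$b_i\le -2\left(d_{\tau(2)}-d_{\tau(1)}\right)\sqrt{6\sqrt3-9}$$ for all $i\in[n]\setminus\{\tau(1)\}$, then $f$ is spherically convex.
   Context: $\langle x,y\rangle=x^\top y$ is the canonical inner product on $\mathbb R^n$, $\|\cdot\|$ the Euclidean norm, $\mathbb S^n=\{x\in\mathbb R^n:\|x\|=1\}$, $[n]=\{1,\dots,n\}$, $\mathbb R^n_+$ is the nonnegative orthant. $\operatorname{diag}(d)$ is the diagonal matrix with diagonal entries $d_1,\dots,d_n$. Geodesics of $\mathbb S^n$ are great circles (intersections of $\mathbb S^n$ with two-dimensional subspaces); a minimal geodesic segment is a shortest great-circle arc joining two points, parametrized proportionally to arc length. A function $f:\mathbb S^n\cap\operatorname{int}(K)\to\mathbb R$ is spherically convex if for every minimal geodesic segment $\gamma:J\to\mathbb S^n\cap\operatorname{int}(K)$ ($J$ an interval), the composition $f\circ\gamma$ is convex on $J$. *)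

(* Defs.v *)
From HB Require Import structures.
From mathcomp Require Import all_boot all_order all_algebra all_fingroup.
From mathcomp Require Import all_classical all_reals all_analysis.
Set Implicit Arguments.
Unset Strict Implicit.
Unset Printing Implicit Defensive.
Import Order.TTheory GRing.Theory Num.Theory.
Import numFieldNormedType.Exports.

Local Open Scope classical_set_scope.
Local Open Scope ring_scope.

Definition dot (R : realType) (n : nat) (x y : 'cV[R]_n) : R :=
  (x^T *m y) ord0 ord0.

(* The library norm on matrices is the sup norm. *)
Definition enorm (R : realType) (n : nat) (x : 'cV[R]_n) : R :=
  Num.sqrt (dot x x).

Definition sphere (R : realType) (n : nat) : set 'cV[R]_n :=
  [set x | enorm x = 1].

Definition orthant (R : realType) (n : nat) : set 'cV[R]_n :=
  [set x | forall i, 0 <= x i ord0].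

Definition great_circle (R : realType) (n : nat) (C : set 'cV[R]_n) : Prop :=
  exists2 U : {vspace 'cV[R]_n}, \dim U = 2%N &
    C = @sphere R n `&` [set x | x \in U].

(* [g] runs on [J] along a great circle, proportionally to arc length, with
   constant speed [w]; the arc it covers over [s, t] has length w * (t - s).
   Values of [g] outside [J] are irrelevant. *)
Definition great_circle_arc (R : realType) (n : nat) (J : set R) (w : R)
    (g : R -> 'cV[R]_n) : Prop :=
  0 <= w /\
  exists C : set 'cV[R]_n, great_circle C /\
  exists p q : 'cV[R]_n,
    [/\ C p, C q, dot p q = 0 &
        forall t, J t -> g t = cos (w * t) *: p + sin (w * t) *: q].

(* Since [J] need not contain its endpoints, minimality is required between
   any two parameters of [J]; for closed bounded [J] this amounts to requiring
   it between the endpoints. *)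
Definition minimal_geodesic (R : realType) (n : nat) (J : set R)
    (g : R -> 'cV[R]_n) : Prop :=
  exists2 w : R, great_circle_arc J w g &
    forall s t : R, J s -> J t -> s <= t ->
    forall (a b v : R) (h : R -> 'cV[R]_n),
      a <= b -> great_circle_arc `[a, b] v h -> h a = g s -> h b = g t ->
      w * (t - s) <= v * (b - a).

Definition spherically_convex (R : realType) (n : nat) (D : set 'cV[R]_n)
    (f : 'cV[R]_n -> R) : Prop :=
  forall (J : set R) (g : R -> 'cV[R]_n),
    is_interval J -> minimal_geodesic J g -> (forall t, J t -> D (g t)) ->
    convex_function (J : set R^o) (f \o g : R^o -> R^o).

(* Main.v *)
Require Import Defs.
From HB Require Import structures.
From mathcomp Require Import all_boot all_order all_algebra all_fingroup.
From mathcomp Require Import all_classical all_reals all_analysis.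
From mathcomp Require Import ring lra.
Set Implicit Arguments.
Unset Strict Implicit.
Unset Printing Implicit Defensive.
Import Order.TTheory GRing.Theory Num.Theory.
Import numFieldNormedType.Exports.

(** Convexity along a great circle is a matter of the second derivative. Let
    k = tau(1), let m be the common value of the other diagonal entries, and put
    D = m - d_k > 0. On the sphere f(x) = m - D x_k^2 + <b, x> + c
    ([quadratic_on_sphere]). Along a great circle of speed w, with position x
    and unit velocity v, the second derivative of f is therefore
      w^2 (2 D (x_k^2 - v_k^2) - <b, x>).
    Since x and v are orthonormal, v_k^2 <= 1 - x_k^2 ([bessel_coord] with
    [harmonic_energy]), so it is enough to show
      <b, x> <= 2 D (2 x_k^2 - 1)
    for x on the sphere with nonnegative entries ([dot_le_on_sphere]). This is
    a condition on y = x_k alone: given y, the bound on <b, x> that follows from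
    the hypotheses is weakest when the sum of the remaining entries is least,
    that is, equal to sqrt (1 - y^2). What remains is
      (1 - y) (1 + 2 y) <= sqrt (6 sqrt 3 - 9) sqrt (1 - y^2),
    and 6 sqrt 3 - 9 is exactly the maximum of (1 - y) (1 + 2 y)^2 / (1 + y)
    over [0, 1] ([cubic_bound]). *)

Local Open Scope classical_set_scope.

Local Open Scope ring_scope.

Lemma dotE (R : realType) (n : nat) (x y : 'cV[R]_n) :
  dot x y = \sum_i x i ord0 * y i ord0.
Proof. by rewrite /dot mxE; apply: eq_bigr => i _; rewrite mxE. Qed.

Lemma dotC (R : realType) (n : nat) (x y : 'cV[R]_n) : dot x y = dot y x.
Proof. by rewrite !dotE; apply: eq_bigr => i _; rewrite mulrC. Qed.

Lemma dot_lin (R : realType) (n : nat) (s t : R) (u p q : 'cV[R]_n) :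
  dot u (s *: p + t *: q) = s * dot u p + t * dot u q.
Proof. by rewrite /dot mulmxDr -!scalemxAr !mxE. Qed.

Lemma sphere_dot1 (R : realType) (n : nat) (x : 'cV[R]_n) :
  sphere x -> dot x x = 1.
Proof.
rewrite /sphere /= /enorm => x1.
have : Num.sqrt (dot x x) ^+ 2 = 1 by rewrite x1 expr1n.
rewrite sqr_sqrtr // dotE sumr_ge0 // => i _; exact: sqr_ge0.
Qed.

(** Bessel's inequality for the k-th basis vector: [u] is its projection on the
    plane of [p] and [q], and both the square norm and the k-th entry of [u] are
    m = p_k^2 + q_k^2, so that m^2 <= m. *)
Lemma bessel_coord (R : realType) (n : nat) (p q : 'cV[R]_n) (k : 'I_n) :
  dot p p = 1 -> dot q q = 1 -> dot p q = 0 ->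
  p k ord0 ^+ 2 + q k ord0 ^+ 2 <= 1.
Proof.
move=> pp qq pq.
set a := p k ord0; set b := q k ord0.
pose u := a *: p + b *: q.
have uu : dot u u = a ^+ 2 + b ^+ 2.
  have up : dot u p = a by rewrite dotC dot_lin pp pq; ring.
  have uq : dot u q = b by rewrite dotC dot_lin qq (dotC q) pq; ring.
  by rewrite dot_lin up uq; ring.
have uk : u k ord0 = a ^+ 2 + b ^+ 2 by rewrite !mxE -/a -/b; ring.
have : u k ord0 ^+ 2 <= dot u u.
  rewrite dotE (bigD1 k) //= expr2 lerDl sumr_ge0 // => i _; exact: sqr_ge0.
rewrite uk uu; set m := _ + _ => mm.
have : 0 <= m by rewrite addr_ge0 // sqr_ge0.
nra.
Qed.

Lemma sum_sqr_le (R : realType) (I : finType) (P : pred I) (x : I -> R) :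
  (forall i, 0 <= x i) ->
  \sum_(i | P i) x i ^+ 2 <= (\sum_(i | P i) x i) ^+ 2.
Proof.
move=> x0; rewrite [leRHS]expr2 mulr_suml ler_sum // => i Pi.
rewrite expr2 ler_wpM2l // (bigD1 i) //= lerDl sumr_ge0 //.
Qed.

(** Here 6 sqrt 3 - 9 is the maximum of (1 - y) (1 + 2 y)^2 / (1 + y) over
    [0, 1], attained at y0 = (sqrt 3 - 1) / 2. With S^2 replaced by its lower
    bound 1 - y^2, squaring the claim and cancelling 1 - y leaves
    (1 - y) (1 + 2 y)^2 <= (6 sqrt 3 - 9) (1 + y), and the difference of the two
    sides factors as 4 (y - y0)^2 (y + 2 y0). *)
Lemma cubic_bound (R : realType) (y S : R) :
  0 <= y <= 1 -> 0 <= S -> 1 - y ^+ 2 <= S ^+ 2 ->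
  (1 - y) * (1 + 2 * y) <= Num.sqrt (6 * Num.sqrt 3 - 9) * S.
Proof.
move=> /andP[y0 y1] S0 yS.
have r2 : Num.sqrt 3 ^+ 2 = 3 :> R by rewrite sqr_sqrtr.
have r0 : 0 <= Num.sqrt 3 :> R by rewrite sqrtr_ge0.
set r := Num.sqrt 3 in r2 r0 *.
(* This makes the radicand 6 r - 9 nonnegative. *)
have r32 : 3 / 2 <= r by nra.
have s0 : 0 <= 6 * r - 9 by lra.
have s2 := sqr_sqrtr s0; have := sqrtr_ge0 (6 * r - 9).
move: s2; set s := Num.sqrt _ => s2 sge0.
rewrite -ler_sqr ?nnegrE ?mulr_ge0 //; [|lra|lra].
have cub : (1 - y) * (1 + 2 * y) ^+ 2 <= (6 * r - 9) * (1 + y).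
  have y00 : 0 <= (r - 1) / 2 by lra.
  rewrite -subr_ge0.
  (* The last summand vanishes because r^2 = 3. *)
  have -> : (6 * r - 9) * (1 + y) - (1 - y) * (1 + 2 * y) ^+ 2 =
      4 * (y - (r - 1) / 2) ^+ 2 * (y + (r - 1))
      + (r ^+ 2 - 3) * (3 * y + 3 - r) by field.
  rewrite r2 subrr mul0r addr0.
  apply: mulr_ge0; last lra.
  by apply: mulr_ge0 => //; exact: sqr_ge0.
rewrite !exprMn s2.
apply: le_trans (_ : (6 * r - 9) * (1 - y ^+ 2) <= _); last exact: ler_wpM2l.
have -> : (1 - y) ^+ 2 * (1 + 2 * y) ^+ 2
  = (1 - y) * ((1 - y) * (1 + 2 * y) ^+ 2) by ring.
have -> : (6 * r - 9) * (1 - y ^+ 2) = (1 - y) * ((6 * r - 9) * (1 + y)) by ring.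
by rewrite ler_wpM2l // subr_ge0.
Qed.

(** With y the k-th entry of x and S the sum of the others, S^2 >= 1 - y^2, and
    the bounds on b give <b, x> <= 2 D (y - sigma S) with
    sigma^2 = 6 sqrt 3 - 9. Since 2 y^2 - 1 = y - (1 - y) (1 + 2 y), the claim
    is then [cubic_bound]. *)
Lemma dot_le_on_sphere (R : realType) (n : nat) (k : 'I_n) (D : R)
    (b x : 'cV[R]_n) :
  0 < D -> b k ord0 <= 2 * D ->
  (forall i, i != k ->
     b i ord0 <= - 2 * D * Num.sqrt (6 * Num.sqrt 3 - 9)) ->
  (forall i, 0 <= x i ord0) -> dot x x = 1 ->
  dot b x <= 2 * D * (2 * x k ord0 ^+ 2 - 1).
Proof.
move=> D0 bk bi x0; rewrite !dotE (bigD1 k) //= => x1.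
rewrite (bigD1 k) //=.
have SS := @sum_sqr_le R _ (fun i => i != k) (fun i => x i ord0) x0.
have S0 : 0 <= \sum_(i | i != k) x i ord0 by rewrite sumr_ge0.
have q0 : 0 <= \sum_(i | i != k) x i ord0 ^+ 2.
  by rewrite sumr_ge0 // => i _; exact: sqr_ge0.
have bS : \sum_(i | i != k) b i ord0 * x i ord0 <=
    - 2 * D * Num.sqrt (6 * Num.sqrt 3 - 9) * \sum_(i | i != k) x i ord0.
  by rewrite mulr_sumr ler_sum // => i ik; rewrite ler_wpM2r // bi.
move: x1 SS S0 bS q0 (x0 k).
under eq_bigr do rewrite -expr2.
set Q := \sum_(i | i != k) _ ^+ 2; set S := \sum_(i | i != k) _.
set y := x k ord0 => x1 SS S0 bS q0 y0.
have y1 : y <= 1 by nra.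
have yS : 1 - y ^+ 2 <= S ^+ 2 by apply: le_trans SS; lra.
have := @cubic_bound R y S; rewrite y0 y1 => /(_ isT S0 yS).
set s := Num.sqrt _ in bS * => cb.
have b1 : b k ord0 * y <= 2 * D * y by rewrite ler_wpM2r.
have : 2 * D * ((1 - y) * (1 + 2 * y)) <= 2 * D * (s * S).
  by rewrite ler_wpM2l // mulr_ge0 // ltW.
lra.
Qed.

(** Second-derivative test on an arbitrary interval. [f] has to agree with the
    smooth function [F] on [J] only, because a geodesic is unconstrained
    outside its interval of parameters. *)
Lemma convex_on_interval (R : realType) (J : set R) (f F F' F'' : R -> R) :
  is_interval J ->
  (forall t : R, is_derive t 1 F (F' t)) ->
  (forall t : R, is_derive t 1 F' (F'' t)) ->
  (forall t, J t -> 0 <= F'' t) ->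
  (forall t, J t -> f t = F t) ->
  convex_function (J : set R^o) (f : R^o -> R^o).
Proof.
move=> Jitv dF dF' F''0 fF.
have D1F : 'D_1 F = F' by apply/funext => t; have [_ ->] := dF t.
have contF t : {for t, continuous F}.
  by apply/differentiable_continuous/derivable1_diffP; have [] := dF t.
have conv (x y : R^o) (t : {i01 R}) : J x -> J y -> x <= y ->
    f (conv t x y) <= conv t (f x : R^o) (f y : R^o).
  move=> Jx Jy xy.
  have := convR_itv t xy; rewrite in_itv /= => xty.
  rewrite !fF //; last exact: (Jitv x y).
  apply: second_derivative_convex => //.
  - move=> z /andP[xz zy]; rewrite D1F.
    have [_ ->] := dF' z.
    by apply: F''0; apply: (Jitv x y) => //; rewrite !ltW.
  - exact/cvg_at_left_filter/contF.
  - exact/cvg_at_right_filter/contF.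
  - by move=> z _; rewrite D1F; have [] := dF' z.
move=> t x y; rewrite !inE => Jx Jy.
have [xy|/ltW yx] := leP (x : R) y; first exact: conv.
by rewrite convC [leRHS]convC; exact: conv.
Qed.

(** An entry, or any linear form, along the great circle through the
    orthonormal vectors whose values are p and q, at speed w. *)
Definition harmonic (R : realType) (w p q t : R) : R :=
  cos (w * t) * p + sin (w * t) * q.

(** Stated so that the derivative is again a [harmonic]: the second derivative is
    then -w^2 times the function, by [harmonicN]. *)
Lemma is_derive_harmonic (R : realType) (w p q t : R) :
  is_derive t 1 (harmonic w p q) (w * harmonic w q (- p) t).
Proof.
have dw : is_derive t 1 (fun u : R => w * u) w.
  have := is_deriveZ w (is_derive_id t (1 : R)).
  by move=> h; apply: is_derive_eq; rewrite /GRing.scale /= mulr1.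
have dc := @is_derive1_comp R (@cos R) (fun u => w * u) t _ _
  (is_derive_cos (w * t)) dw.
have ds := @is_derive1_comp R (@sin R) (fun u => w * u) t _ _
  (is_derive_sin (w * t)) dw.
have -> : harmonic w p q =
    p *: (@cos R \o *%R w) + q *: (@sin R \o *%R w).
  by apply/funext => u; rewrite /harmonic !fctE /GRing.scale /=; ring.
apply: is_derive_eq; rewrite /harmonic /GRing.scale /=; ring.
Qed.

Lemma harmonicN (R : realType) (w p q t : R) :
  harmonic w (- p) (- q) t = - harmonic w p q t.
Proof. by rewrite /harmonic; ring. Qed.

(** For w <> 0 the second summand is the square of the derivative divided by
    w^2. *)
Lemma harmonic_energy (R : realType) (w p q t : R) :
  harmonic w p q t ^+ 2 + harmonic w q (- p) t ^+ 2 = p ^+ 2 + q ^+ 2.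
Proof.
rewrite /harmonic -[RHS]mul1r -(cos2Dsin2 (w * t)); ring.
Qed.

(** diag d = m I - (m - d_k) e_k e_k^T, and the part m I is constant on the
    sphere. *)
Lemma quadratic_on_sphere (R : realType) (n : nat) (k : 'I_n) (m : R)
    (d x : 'cV[R]_n) :
  (forall i, i != k -> d i ord0 = m) -> dot x x = 1 ->
  dot (diag_mx d^T *m x) x = m - (m - d k ord0) * x k ord0 ^+ 2.
Proof.
move=> dm; rewrite !dotE (bigD1 k) //= => x1.
under eq_bigr do rewrite mul_diag_mx !mxE -mulrA.
rewrite (bigD1 k) //=; under eq_bigr do rewrite dm //.
rewrite -mulr_sumr.
move: x1; set Q := \sum_(i | _) _ => x1.
have -> : Q = 1 - x k ord0 * x k ord0 by rewrite -x1; ring.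
ring.
Qed.

Theorem theorem6 (R : realType) (n : nat) (hn : (3 <= n)%N)
    (d : 'cV[R]_n) (tau : 'S_n)
    (i1 i2 : 'I_n) (hi1 : i1 = 0%N :> nat) (hi2 : i2 = 1%N :> nat)
    (hd12 : d (tau i1) ord0 < d (tau i2) ord0)
    (hd2 : forall i : 'I_n, (1 <= i)%N -> d (tau i) ord0 = d (tau i2) ord0)
    (b : 'cV[R]_n) (c : R)
    (hb1 : b (tau i1) ord0 <= 2 * (d (tau i2) ord0 - d (tau i1) ord0))
    (hb : forall i : 'I_n, i != tau i1 ->
       b i ord0 <= - 2 * (d (tau i2) ord0 - d (tau i1) ord0)
                     * Num.sqrt (6 * Num.sqrt 3 - 9)) :
  spherically_convex (@sphere R n `&` (@orthant R n)°)
    (fun x => dot (diag_mx d^T *m x) x + dot b x + c).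
Proof.
move=> J g Jitv [w [w0 [C [[U _ ->] [p [q [[Sp _] [Sq _] pq gE]]]]]] _] gD.
have dk i : i != tau i1 -> d i ord0 = d (tau i2) ord0.
  move=> ik; rewrite -(permKV tau i) hd2 // lt0n; apply: contraNneq ik => i0.
  have -> : i1 = (tau^-1)%g i by apply/val_inj; rewrite /= hi1 i0.
  by rewrite permKV.
move: hb1 hb hd12 dk; set k := tau i1; set m := d (tau i2) ord0.
rewrite -subr_gt0; set D := m - _ => bk bi D0 dk.
pose x_k := harmonic w (p k ord0) (q k ord0).
pose v_k := harmonic w (q k ord0) (- p k ord0).
have gk t : J t -> g t k ord0 = x_k t by move=> Jt; rewrite gE // !mxE.
have gb t : J t -> dot b (g t) = harmonic w (dot b p) (dot b q) t.
  by move=> Jt; rewrite gE // dot_lin.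
(* F is f along the great circle; F' and F'' are its derivatives. *)
pose F t := - D * x_k t ^+ 2 + harmonic w (dot b p) (dot b q) t + (m + c).
pose F' t := - 2 * D * w * (x_k t * v_k t)
  + w * harmonic w (dot b q) (- dot b p) t.
pose F'' t := w ^+ 2 *
  (2 * D * (x_k t ^+ 2 - v_k t ^+ 2) - harmonic w (dot b p) (dot b q) t).
apply: (@convex_on_interval R J _ F F' F'') => //.
- move=> t; have dx := is_derive_harmonic w (p k ord0) (q k ord0) t.
  have dh := is_derive_harmonic w (dot b p) (dot b q) t.
  have -> : F = (- D) *: (x_k ^+ 2) + harmonic w (dot b p) (dot b q)
      + cst (m + c).
    by apply/funext => u; rewrite !fctE.
  apply: is_derive_eq; rewrite /F' /GRing.scale /= -/x_k -/v_k; ring.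
- move=> t; have dx := is_derive_harmonic w (p k ord0) (q k ord0) t.
  have dv := is_derive_harmonic w (q k ord0) (- p k ord0) t.
  have dh := is_derive_harmonic w (dot b q) (- dot b p) t.
  have -> : F' = (- 2 * D * w) *: (x_k * v_k)
      + w *: harmonic w (dot b q) (- dot b p).
    by apply/funext => u; rewrite !fctE.
  apply: is_derive_eq; rewrite /F'' /GRing.scale /= !harmonicN -/x_k -/v_k.
  ring.
- move=> t Jt; have [/sphere_dot1 g1 /interior_subset g0] := gD t Jt.
  have := dot_le_on_sphere D0 bk bi g0 g1; rewrite gb // gk // => bx.
  have := bessel_coord k (sphere_dot1 Sp) (sphere_dot1 Sq) pq.
  rewrite -(harmonic_energy w _ _ t) -/x_k -/v_k => xv.
  rewrite mulr_ge0 ?sqr_ge0 // subr_ge0 (le_trans bx) //.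
  rewrite ler_wpM2l ?mulr_ge0 ?(ltW D0) //; lra.
- move=> t Jt; have [/sphere_dot1 g1 _] := gD t Jt.
  rewrite /= (quadratic_on_sphere dk g1) gb // gk // /F -/D; ring.
Qed.
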